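(* Let $f\in A_2$ be such that $f=\alpha_0u_0+\alpha_1u_1+\alpha_2u_0u_1$ for some $\alpha_0,\alpha_1,\alpha_2\in\mathbb{C}$. It holds that $$\mathsf{L}^{\lambda}_{\mathcal{T}_{\mathcal{C}}}(f)=\max\{2|\alpha_0+\alpha_1-\alpha_2|,\ 2|\alpha_0-\alpha_1+\alpha_2|,\ 2|\alpha_0-\alpha_1-\alpha_2|,\ 2|\alpha_0+\alpha_1+\alpha_2|,\ 4|\alpha_1-\alpha_2|,\ 4|\alpha_1+\alpha_2|\}.$$
   Context: Convention: $\mathbb{N}$ contains $0$. The Cantor space is $\mathcal{C}=\{(x_n)_{n\in\mathbb{N}} : x_n\in\{0,1\} \text{ for all } n\}$ with its (product) topology. $C(\mathcal{C})$ is the C*-algebra of continuous functions $\mathcal{C}\to\mathbb{C}$ with pointwise operations, supremum norm $\|\cdot\|_\infty$ and unit $1_{C(\mathcal{C})}$ (the constant function $1$). For $n\in\mathbb{N}$, $\eta_n\in C(\mathcal{C})$ is the coordinate map $\eta_n((z_m)_{m\in\mathbb{N}})=z_n$, and $u_n=2\eta_n-1_{C(\mathcal{C})}$ (so $u_n$ takes values in $\{-1,1\}$). Set $B_0=\emptyset$ and, for $n\geq 1$, $B_n=\{\prod_{j\in F}u_j : \emptyset\neq F\subseteq\{0,\ldots,n-1\}\}$. For $n \in \mathbb{N}$ set $B_n'=\{1_{C(\mathcal{C})}\}\cup B_n$ and $A_n=\operatorname{span}_{\mathbb{C}} B_n'$; in particular $A_2=\operatorname{span}_{\mathbb{C}}\{1_{C(\mathcal{C})},u_0,u_1,u_0u_1\}$.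 $\lambda$ is the state on $C(\mathcal{C})$ (unital norm-one continuous linear functional) determined by $\lambda\left(\prod_{j\in F}u_j\right)=0$ for every nonempty finite $F\subset\mathbb{N}$; it is integration against the product of the uniform probability measures on $\{0,1\}$. For $n\in\mathbb{N}$, $E_n:C(\mathcal{C})\to A_n$ is $E_n(f)=\sum_{a\in B_n'}\lambda(fa)\,a$. The seminorm $\mathsf{L}^{\lambda}_{\mathcal{T}_{\mathcal{C}}}$ (with values in $[0,\infty]$) is, for $f\in C(\mathcal{C})$, $$\mathsf{L}^{\lambda}_{\mathcal{T}_{\mathcal{C}}}(f)=\sup_{n\in\mathbb{N}}\frac{\|f-E_n(f)\|_\infty}{2^{-(n+1)}}.$$ *)

(* Defs.v *)
From HB Require Import structures.
From mathcomp Require Import all_boot all_order all_algebra finmap.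
From mathcomp Require Import all_classical all_reals all_analysis.
From mathcomp Require Import complex.
Set Implicit Arguments.
Unset Strict Implicit.
Unset Printing Implicit Defensive.
Import Order.TTheory GRing.Theory Num.Theory.
Import numFieldNormedType.Exports.
Local Open Scope classical_set_scope.
Local Open Scope ring_scope.

(* The library only topologizes numeric fields that are variables; this gives
   R[i] the topology of its modulus. *)
HB.instance Definition _ (R : realType) := NormedModule.copy R[i] R[i]^o.

(* Pointwise commutative R[i]-algebra structure on continuous functions. *)
Section continuous_algebra.
Context (R : realType) (X : ptopologicalType).
Local Notation C := R[i].

Lemma continuous_sub (f g : X -> C) :
  continuous f -> continuous g -> continuous (fun x => f x - g x).
Proof. by move=> fc gc x; apply: cvgB; [exact: fc|exact: gc]. Qed.

Lemma continuous_mul (f g : X -> C) :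
  continuous f -> continuous g -> continuous (fun x => f x * g x).
Proof. by move=> fc gc x; apply: cvgM; [exact: fc|exact: gc]. Qed.

Definition ctsfun : {pred X -> C} := mem [set f : X -> C | continuous f].

Section Sub.
Context (f : X -> C) (fP : f \in ctsfun).
Definition ctsfun_Sub : continuousType X C := mkcts (set_mem fP).
End Sub.

Lemma ctsfun_rect (K : continuousType X C -> Type) :
  (forall f (Pf : f \in ctsfun), K (ctsfun_Sub Pf)) -> forall g, K g.
Proof.
move=> Ksub g.
have Pg : (g : X -> C) \in ctsfun by rewrite inE; exact: cts_fun.
by have <- : ctsfun_Sub Pg = g by exact/continuousEP.
Qed.

Lemma ctsfun_valP f (Pf : f \in ctsfun) : ctsfun_Sub Pf = f :> (_ -> _).
Proof. by []. Qed.

HB.instance Definition _ :=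
  isSub.Build _ _ (continuousType X C) ctsfun_rect ctsfun_valP.

Lemma ctsfun_subring_closed : subring_closed ctsfun.
Proof.
split; first by rewrite inE/=; exact: cst_continuous.
- move=> f g /set_mem fc /set_mem gc; apply/mem_set.
  exact: continuous_sub fc gc.
- move=> f g /set_mem fc /set_mem gc; apply/mem_set.
  exact: continuous_mul fc gc.
Qed.

HB.instance Definition _ :=
  GRing.isSubringClosed.Build _ ctsfun ctsfun_subring_closed.

HB.instance Definition _ :=
  [SubChoice_isSubComNzRing of continuousType X C by <:].

Lemma ctsfun_scaler_closed : scaler_closed ctsfun.
Proof.
move=> a f /set_mem fc; apply/mem_set.
by apply: (@continuous_mul (fun=> a)) => //; exact: cst_continuous.
Qed.

HB.instance Definition _ :=
  GRing.isScaleClosed.Build _ _ ctsfun ctsfun_scaler_closed.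

HB.instance Definition _ :=
  [SubZmodule_isSubLmodule of continuousType X C by <:].

Lemma ctsfunB (f g : continuousType X C) x : (f - g) x = f x - g x.
Proof. by []. Qed.

Lemma ctsfunD (f g : continuousType X C) x : (f + g) x = f x + g x.
Proof. by []. Qed.

Lemma ctsfunM (f g : continuousType X C) x : (f * g) x = f x * g x.
Proof. by []. Qed.

Lemma ctsfun1 x : (1 : continuousType X C) x = 1.
Proof. by []. Qed.

Lemma ctsfunZ a (f : continuousType X C) x : (a *: f) x = a * f x.
Proof. by []. Qed.

End continuous_algebra.

Notation Ccantor R := (continuousType cantor_space R[i]).
Notation cmod := ComplexField.Normc.normc.

Definition linear_span (K : nzRingType) (V : lmodType K) (S : set V) : set V :=
  [set v | exists (s : seq V) (c : V -> K),
     (forall a, a \in s -> S a) /\ v = \sum_(a <- s) c a *: a].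

Section cantor.
Context (R : realType).
Implicit Types (n : nat) (f : Ccantor R) (l : {scalar (Ccantor R)}).

(* A supremum in R (not \bar R): the set is nonempty, and bounded because
   cantor_space is compact. *)
Definition supnorm f : R := sup [set cmod (f x) | x in [set: cantor_space]].

Lemma coord_continuous n : continuous (fun z : cantor_space => (z n)%:R : R[i]).
Proof.
move=> z.
apply: (@continuous_comp cantor_space bool R[i] (fun z => z n) (fun b => b%:R)).
  exact: (@proj_continuous nat (fun=> bool)).
move=> W /nbhs_singleton Wz.
apply: (@filterS bool (nbhs (z n)) _ _ _ _ (discrete_set1 (z n))).
by move=> _ ->.
Qed.

Definition cantor_eta n : Ccantor R := mkcts (@coord_continuous n).

Definition cantor_u n : Ccantor R := 2 *: cantor_eta n - 1.

Definition cantor_B n : set (Ccantor R) :=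
  [set a | exists F : {fset nat}, [/\ F != fset0,
     (forall j, j \in F -> (j < n)%N) & a = \prod_(j <- F) cantor_u j]].

Definition cantor_B' n : set (Ccantor R) := [set 1] `|` cantor_B n.

Definition cantor_A n : set (Ccantor R) := linear_span (cantor_B' n).

Definition supnorm_continuous l : Prop :=
  forall f (e : R), 0 < e -> exists2 d : R, 0 < d &
    forall g : Ccantor R, supnorm (g - f) < d -> cmod (l g - l f) < e.

Definition dual_norm l : \bar R :=
  ereal_sup [set (cmod (l f))%:E | f in [set f | supnorm f <= 1]].

Definition is_state l : Prop :=
  [/\ supnorm_continuous l, dual_norm l = 1%:E & l 1 = 1].

(* By density of the span of the products of the [cantor_u j], exactly one state
   satisfies this: integration against the product of the uniform probability
   measures on {0, 1}. *)
Definition is_lambda l : Prop := is_state l /\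
  forall F : {fset nat}, F != fset0 -> l (\prod_(j <- F) cantor_u j) = 0.

(* The finitely supported sum [\sum_(_ \in _)] is 0 when the support is infinite;
   this never happens here, as [cantor_B' n] is finite. *)
Definition cantor_E l n f : Ccantor R :=
  \sum_(a \in cantor_B' n) l (f * a) *: a.

Definition cantor_L l f : \bar R :=
  ereal_sup [set (supnorm (f - cantor_E l n f) / 2 ^- n.+1)%:E
            | n in [set: nat]].

End cantor.

(* Main.v *)
(* Write w_F for the product of the u_j, j in F (Walsh functions).  As u_j^2 = 1,
   w_F w_G is w of the symmetric difference, so the w_F are orthonormal for
   lambda and E_n fixes w_F when F is a subset of {0, ..., n-1} and kills it
   otherwise.  Hence f - E_n f is f for n = 0, alpha1 u_1 + alpha2 u_0 u_1 for
   n = 1, and 0 for n >= 2; the first two take finitely many values, indexed by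
   the signs of u_0 and u_1. *)
Require Import Defs.
From mathcomp Require Import all_boot all_order all_algebra finmap.
From mathcomp Require Import all_classical all_reals all_analysis.
From mathcomp Require Import complex ring.
Import Order.TTheory GRing.Theory Num.Theory.
Import numFieldNormedType.Exports.
Local Open Scope classical_set_scope.
Local Open Scope ring_scope.

Local Notation walsh R F := (\prod_(j <- (F : {fset nat})) cantor_u R j).

(** With a boolean exponent on -1, multiplying signs becomes exclusive or, which makes the square of
    [cantor_u] trivial. *)
Lemma cantor_uE (R : realType) n z : cantor_u R n z = (-1) ^+ ~~ z n.
Proof.
rewrite ctsfunB ctsfunZ ctsfun1 -[cantor_eta R n z]/((z n)%:R).
by case: (z n); rewrite /= ?expr0 ?expr1; ring.
Qed.

Lemma cantor_u_sqr (R : realType) n : cantor_u R n * cantor_u R n = 1.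
Proof.
apply/continuousEP => z.
by rewrite ctsfunM cantor_uE -signr_addb addbb.
Qed.

(** Padding with factors 1 brings products over different sets to a common index set, where they can
    be compared factor by factor. *)
Lemma prod_fset_if (A : comNzRingType) (F S : {fset nat}) (u : nat -> A) :
  (F `<=` S)%fset ->
  \prod_(j <- F) u j = \prod_(j <- S) (if j \in F then u j else 1).
Proof.
move=> FS; rewrite -(big_fset_incl _ FS) => [|j _ /negbTE ->//].
by apply: eq_big_seq => j ->.
Qed.

Lemma walshM (R : realType) (F G : {fset nat}) :
  walsh R F * walsh R G = walsh R ((F `\` G) `|` (G `\` F))%fset.
Proof.
set D := (_ `|` _)%fset.
have DS : (D `<=` F `|` G)%fset.
  by apply/fsubsetP => j; rewrite !in_fsetE => /orP[] /andP[_ ->]; rewrite ?orbT.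
rewrite (prod_fset_if _ _ _ _ (fsubsetUl F G)) (prod_fset_if _ _ _ _ (fsubsetUr F G)).
rewrite (prod_fset_if _ _ _ _ DS) -big_split; apply: eq_bigr => j _ /=.
rewrite !in_fsetE; case: (j \in F); case: (j \in G) => /=;
  by rewrite ?mulr1 ?mul1r ?cantor_u_sqr.
Qed.

Lemma lambda_walshM (R : realType) (l : {scalar (Ccantor R)})
    (F G : {fset nat}) :
  is_lambda l -> l (walsh R F * walsh R G) = (F == G)%:R.
Proof.
move=> [[_ _ l1] l0]; rewrite walshM; case: eqVneq => [->|FG].
  by rewrite fsetDv fsetU0 big_nil l1.
(* An empty symmetric difference forces both inclusions, hence [F = G]. *)
apply: l0; apply: contra_neq FG => /eqP; rewrite fsetU_eq0 !fsetD_eq0.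
by move=> /andP[FG GF]; apply/eqP; rewrite eqEfsubset FG.
Qed.

(** The constant 1 is the Walsh function of the empty set, so adjoining it to [cantor_B] completes
    the powerset. This form yields finiteness and turns membership into an inclusion of index
    sets. *)
Lemma cantor_B'E (R : realType) n :
  @cantor_B' R n =
  [set walsh R F | F in [set` fpowerset [fset j in iota 0 n]%fset]].
Proof.
have sub (F : {fset nat}) : (forall j, j \in F -> (j < n)%N) <->
    F \in fpowerset [fset j in iota 0 n]%fset.
  rewrite fpowersetE; split => [h|/fsubsetP h j /h].
    by apply/fsubsetP => j /h jn; rewrite in_fsetE /= mem_iota.
  by rewrite in_fsetE /= mem_iota.
apply/seteqP; split => [a [->|[F [_ /sub Fn ->]]]|_ [F /= /sub Fn <-]].
- by exists fset0; [apply/sub => j; rewrite in_fset0|rewrite big_nil].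
- by exists F.
- have [->|F0] := eqVneq F fset0; first by left; rewrite big_nil.
  by right; exists F.
Qed.

Lemma finite_cantor_B' (R : realType) n : finite_set (@cantor_B' R n).
Proof. by rewrite cantor_B'E; apply: finite_image; exact: finite_fset. Qed.

Lemma ctsfun_scalerAl (R : realType) (X : ptopologicalType) (c : R[i])
    (f g : continuousType X R[i]) : c *: (f * g) = (c *: f) * g.
Proof.
by apply/continuousEP => x; rewrite ctsfunM !ctsfunZ ctsfunM mulrA.
Qed.

Lemma cantor_E_linear (R : realType) (l : {scalar (Ccantor R)}) n c f g :
  cantor_E l n (c *: f + g) = c *: cantor_E l n f + cantor_E l n g.
Proof.
have fin := finite_cantor_B' R n.
(* Finiteness turns all three sums into ordinary sums over the same index set, so linearity is
   checked termwise. *)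
rewrite /cantor_E !fsbig_finite //= scaler_sumr -big_split /=.
apply: eq_bigr => a _.
by rewrite mulrDl -ctsfun_scalerAl linearP scalerDl scalerA.
Qed.

Lemma cantor_E0 (R : realType) (l : {scalar (Ccantor R)}) n :
  cantor_E l n 0 = 0.
Proof. by apply: fsbig1 => a _; rewrite mul0r linear0 scale0r. Qed.

Lemma cantor_E_walsh (R : realType) (l : {scalar (Ccantor R)}) n
    (F : {fset nat}) : is_lambda l ->
  cantor_E l n (walsh R F) =
  if (F `<=` [fset j in iota 0 n])%fset then walsh R F else 0.
Proof.
move=> hl; rewrite /cantor_E; case: ifPn => Fn; last first.
  (* Every [G] indexing the sum lies in {0, ..., n-1} and so differs from [F]: each coefficient
     vanishes. *)
  apply: fsbig1 => a; rewrite cantor_B'E => -[G /=].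
  rewrite fpowersetE => Gn <-; rewrite lambda_walshM //.
  by case: eqVneq => [FG|_]; rewrite ?scale0r//; rewrite FG Gn in Fn.
(* By orthonormality only the term at [walsh R F] survives, with coefficient 1. *)
rewrite -(fsbig_widen [set walsh R F]).
- by rewrite fsbig_set1 lambda_walshM// eqxx scale1r.
- by move=> _ ->; rewrite cantor_B'E; exists F; rewrite //= fpowersetE.
- move=> a [] /=; rewrite cantor_B'E => -[G _ <-] GF.
  rewrite lambda_walshM //; case: eqVneq => [FG|_]; last by rewrite scale0r.
  by case: GF; rewrite FG.
Qed.

Lemma cmod_ge0 (R : realType) (x : R[i]) : 0 <= cmod x.
Proof. by case: x => a b; exact: sqrtr_ge0. Qed.

Lemma supnorm_attained (R : realType) (f : Ccantor R) m :
  (forall x, cmod (f x) <= m) -> (exists x, cmod (f x) = m) -> supnorm f = m.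
Proof.
move=> fm [x fx]; apply/le_anti/andP; split.
  by apply: ge_sup; [exists (cmod (f x)), x|move=> _ [y _ <-]].
by apply: ub_le_sup; [exists m => _ [y _ <-]|exists x].
Qed.

Lemma supnorm_u0_u1_u0u1 (R : realType) (a b c : R[i]) :
  supnorm (a *: cantor_u R 0 + b *: cantor_u R 1
           + c *: (cantor_u R 0 * cantor_u R 1)) =
  Num.max (cmod (a + b - c)) (Num.max (cmod (a - b + c))
    (Num.max (cmod (a - b - c)) (cmod (a + b + c)))).
Proof.
set f := (X in supnorm X).
have fE z : cmod (f z) =
    if z 0%N then if z 1%N then cmod (a + b + c) else cmod (a - b - c)
    else if z 1%N then cmod (a - b + c) else cmod (a + b - c).
  rewrite /f !ctsfunD !ctsfunZ ctsfunM !cantor_uE.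
  (* When [z 0] is false, the value of [f] is the opposite of the listed expression; the modulus
     does not see this. *)
  case: (z 0%N); case: (z 1%N) => /=; rewrite ?expr0 ?expr1 ?mulNr ?mulrN;
    rewrite ?mulr1 ?mul1r ?opprK// -normcN; congr cmod; ring.
apply: supnorm_attained => [z|].
  by rewrite fE; case: (z 0%N); case: (z 1%N); rewrite !le_max lexx ?orbT.
(* Only coordinates 0 and 1 matter; the point attaining the supremum is the sign pattern of
   whichever modulus is largest. *)
pose pt (s t : bool) : cantor_space := fun n => if n is 0 then s else t.
case: leP => _; first case: leP => _; first case: leP => _.
- by exists (pt true true); rewrite fE.
- by exists (pt true false); rewrite fE.
- by exists (pt false true); rewrite fE.
- by exists (pt false false); rewrite fE.
Qed.

Theorem theorem3p2 (R : realType) (lambda : {scalar (Ccantor R)})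
  (hlambda : is_lambda lambda) (f : Ccantor R) (hf : cantor_A 2 f)
  (alpha0 alpha1 alpha2 : R[i])
  (hfE : f = alpha0 *: cantor_u R 0 + alpha1 *: cantor_u R 1
             + alpha2 *: (cantor_u R 0 * cantor_u R 1)) :
  cantor_L lambda f =
    (Num.max (2 * cmod (alpha0 + alpha1 - alpha2))
    (Num.max (2 * cmod (alpha0 - alpha1 + alpha2))
    (Num.max (2 * cmod (alpha0 - alpha1 - alpha2))
    (Num.max (2 * cmod (alpha0 + alpha1 + alpha2))
    (Num.max (4 * cmod (alpha1 - alpha2))
             (4 * cmod (alpha1 + alpha2)))))))%:E.
Proof.
have w0 : walsh R [fset 0%N]%fset = cantor_u R 0 by rewrite big_seq_fset1.
have w1 : walsh R [fset 1%N]%fset = cantor_u R 1 by rewrite big_seq_fset1.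
have w01 : walsh R [fset 0%N; 1%N]%fset = cantor_u R 0 * cantor_u R 1.
  by rewrite big_fsetU1 ?in_fset1//= big_seq_fset1.
have fEn n : f - cantor_E lambda n f =
    (if (0 < n)%N then 0 else alpha0) *: cantor_u R 0
    + (if (1 < n)%N then 0 else alpha1) *: cantor_u R 1
    + (if (1 < n)%N then 0 else alpha2) *: (cantor_u R 0 * cantor_u R 1).
  have -> : cantor_E lambda n f =
      (if (0 < n)%N then alpha0 else 0) *: cantor_u R 0
      + (if (1 < n)%N then alpha1 else 0) *: cantor_u R 1
      + (if (1 < n)%N then alpha2 else 0) *: (cantor_u R 0 * cantor_u R 1).
    (* The trailing 0 gives the last summand the shape [c *: f + g] too, so linearity applies three
       times. *)
    rewrite hfE -w01 -w0 -w1 -addrA -[X in _ + (_ + X)]addr0.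
    rewrite !cantor_E_linear cantor_E0 !cantor_E_walsh// addr0.
    rewrite fsubUset !fsub1set !in_fsetE /= !mem_iota /=.
    by case: n => [|[|n]] /=; rewrite ?scaler0 ?scale0r ?addr0 ?addrA.
  rewrite hfE; case: n => [|[|n]] /=; rewrite ?scale0r ?addr0 ?add0r ?subr0//.
  - by apply/eqP; rewrite subr_eq -addrA addrC.
  - by rewrite subrr.
have L0 : supnorm (f - cantor_E lambda 0 f) =
    Num.max (cmod (alpha0 + alpha1 - alpha2))
    (Num.max (cmod (alpha0 - alpha1 + alpha2))
    (Num.max (cmod (alpha0 - alpha1 - alpha2))
             (cmod (alpha0 + alpha1 + alpha2)))).
  by rewrite fEn /= supnorm_u0_u1_u0u1.
have L1 : supnorm (f - cantor_E lambda 1 f) =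
    Num.max (cmod (alpha1 - alpha2)) (cmod (alpha1 + alpha2)).
  rewrite fEn /= supnorm_u0_u1_u0u1 !add0r.
  (* Without the [cantor_u R 0] term the four values are pairwise opposite, leaving two moduli. *)
  rewrite -(normcN (- alpha1 + _)) -(normcN (- alpha1 - _)) !opprD !opprK.
  by rewrite maxxx maxA maxxx.
have L2 n : supnorm (f - cantor_E lambda n.+2 f) = 0.
  rewrite fEn /= supnorm_u0_u1_u0u1 !(oppr0, addr0) !maxxx.
  by rewrite /= expr0n addr0 sqrtr0.
rewrite !maxA.
(* The factors 2 and 4 are the inverses of [2 ^- n.+1] at n = 0 and n = 1. All later terms are 0,
   below a maximum of nonnegative numbers. *)
transitivity ((Num.max (supnorm (f - cantor_E lambda 0 f) * 2)
                       (supnorm (f - cantor_E lambda 1 f) * 4))%:E).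
  rewrite /cantor_L; apply/le_anti/andP; split.
    apply: ge_ereal_sup => _ [[|[|n]] _ <-]; rewrite lee_fin le_max.
    - by rewrite expr1 invrK lexx.
    - by rewrite invrK -natrX lexx orbT.
    - by rewrite L2 mul0r L0 mulr_ge0// !le_max cmod_ge0.
  rewrite EFin_max ge_max; apply/andP; split; apply: ereal_sup_ubound.
  - by exists 0%N => //; rewrite expr1 invrK.
  - by exists 1%N => //; rewrite invrK -natrX.
by rewrite L0 L1 -!(mulrC (_%:R)) !maxr_pMr// !maxA.
Qed.
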